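(* For the single-segment ($m=1$) min-max-energy platooning problem with arbitrary $n$ and arbitrary vehicle parameters (minimize $\max_{1\le j\le n}D_1\delta_j(1-\eta_{[j]})$ over permutations $([1],\ldots,[n])$ of $(1,\ldots,n)$ subject to $S_{j1}-\frac{D_1\delta_j(1-\eta_{[j]})}{C_j}\ge\beta_j$ for $j=1,\ldots,n$), Algorithm Delta solves the problem in $O(n^2)$ time.
   Context: Setting. There are $n$ vehicles and one road segment of length $D_1>0$. Vehicle $j$ has battery capacity $C_j>0$, usage rate $\delta_j>0$, initial state of charge $S_{j1}\in[0,1]$, and minimum allowable state of charge $\beta_j$ with $0\le\beta_j<S_{j1}$. Platoon positions have usage-rate reductions $0\le\eta_1\le\cdots\le\eta_n<1$. A solution is a permutation $([1],\ldots,[n])$, where $[j]$ is the position of vehicle $j$; vehicle $j$ then uses energy $D_1\delta_j(1-\eta_{[j]})$ and its final state of charge is $S_{j1}-D_1\delta_j(1-\eta_{[j]})/C_j$. A solution is feasible if every final state of charge is at least $\beta_j$. Solving the problem means finding an optimal solution, or proving infeasibility if there is no feasible solution. Write $\lambda_k=1-\eta_k$. Algorithm Delta. Step 0: Reindex the vehicles in non-decreasing order of $\delta_j$ (ties by increasing initial index). For $k=1,\ldots,n$ let $E_k=\{j : S_{j1}-\frac{\delta_j}{C_j}D_1\lambda_k\ge\beta_j\}$. Set $q=1$ and $V=\emptyset$. Step 1: If $E_q$ is empty, declare the problem infeasible. Otherwise assign the vehicle $u\in E_q$ with smallest index to position $q$. Step 2: If $q=n$, stop. Otherwise set $V=V\cup\{u\}$,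 $E_{q+1}=E_{q+1}\setminus V$, $q=q+1$, and go to Step 1. Running time counts elementary arithmetic operations and comparisons. *)

(* Defs.v *)
From mathcomp Require Import all_boot all_order all_algebra all_fingroup.

Set Implicit Arguments.
Unset Strict Implicit.
Unset Printing Implicit Defensive.

Import Order.TTheory GRing.Theory Num.Theory.
Local Open Scope ring_scope.

(* Vehicles and positions are both numbered by 'I_n.  The carrier V is kept
   abstract so that algorithms can be written for an arbitrary V. *)
Record instance (V : Type) (n : nat) := Instance {
  len : V;              (* D_1 *)
  cap : 'I_n -> V;      (* C_j *)
  rate : 'I_n -> V;     (* delta_j *)
  soc : 'I_n -> V;      (* S_{j1} *)
  minsoc : 'I_n -> V;   (* beta_j *)
  red : 'I_n -> V       (* eta_k, for position k *)
}.

Section Problem.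
Variables (R : realFieldType) (n : nat) (I : instance R n).

Definition valid : Prop :=
  [/\ 0 < len I,
      forall j, 0 < cap I j /\ 0 < rate I j,
      forall j, 0 <= soc I j <= 1,
      forall j, 0 <= minsoc I j < soc I j
    & (forall k, 0 <= red I k < 1) /\
      (forall k l : 'I_n, (k <= l)%N -> red I k <= red I l)].

(* In a solution p, the position of vehicle j is p j. *)
Definition energy (p : {perm 'I_n}) (j : 'I_n) : R :=
  len I * rate I j * (1 - red I (p j)).

Definition final_soc (p : {perm 'I_n}) (j : 'I_n) : R :=
  soc I j - energy p j / cap I j.

Definition feasible (p : {perm 'I_n}) : Prop :=
  forall j, minsoc I j <= final_soc p j.

(* All energies are positive in a valid instance, so for n > 0 the default
   value 0 does not affect the maximum. *)
Definition max_energy (p : {perm 'I_n}) : R :=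
  \big[Num.max/0]_(j < n) energy p j.

Definition optimal (p : {perm 'I_n}) : Prop :=
  feasible p /\ forall p', feasible p' -> max_energy p <= max_energy p'.

(* The vehicles listed from the first position to the last one. *)
Definition lineup (p : {perm 'I_n}) : seq 'I_n :=
  [seq (p^-1)%g k | k <- enum 'I_n].

(* An answer is a line-up, or None for a declaration of infeasibility. *)
Definition solves (answer : option (seq 'I_n)) : Prop :=
  match answer with
  | Some s => exists2 p, s = lineup p & optimal p
  | None => forall p, ~ feasible p
  end.

End Problem.

Variant arith_op := Add | Sub | Mul | Div.

(* Programs over an abstract type V of numbers, returning a value in A.  A
   program that is polymorphic in V can only compute with numbers and compare
   them through the instructions below, each of which has unit cost.  Step
   charges for visiting one list cell, together with the bounded number of
   operations on indices and Booleans done there; in the programs below every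
   recursive call is charged in this way. *)
Inductive prog (V A : Type) : Type :=
| Ret of A
| One of (V -> prog V A)
| Arith of arith_op & V & V & (V -> prog V A)
| Leq of V & V & (bool -> prog V A)
| Step of prog V A.

Arguments Ret {V A}.
Arguments One {V A}.
Arguments Arith {V A}.
Arguments Leq {V A}.
Arguments Step {V A}.

Fixpoint bind (V A B : Type) (m : prog V A) (f : A -> prog V B) : prog V B :=
  match m with
  | Ret a => f a
  | One k => One (fun x => bind (k x) f)
  | Arith o x y k => Arith o x y (fun z => bind (k z) f)
  | Leq x y k => Leq x y (fun b => bind (k b) f)
  | Step m' => Step (bind m' f)
  end.

Notation "'let!' x ':=' m 'in' k" := (bind m (fun x => k))
  (at level 200, x name, k at level 200).

Section Semantics.
Variable R : realFieldType.

Definition arith_eval (o : arith_op) (x y : R) : R :=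
  match o with Add => x + y | Sub => x - y | Mul => x * y | Div => x / y end.

Fixpoint eval (A : Type) (m : prog R A) : A :=
  match m with
  | Ret a => a
  | One k => eval (k 1)
  | Arith o x y k => eval (k (arith_eval o x y))
  | Leq x y k => eval (k (x <= y))
  | Step m' => eval m'
  end.

Fixpoint cost (A : Type) (m : prog R A) : nat :=
  match m with
  | Ret _ => 0
  | One k => (cost (k 1%R)).+1
  | Arith o x y k => (cost (k (arith_eval o x y))).+1
  | Leq x y k => (cost (k (x <= y)%R)).+1
  | Step m' => (cost m').+1
  end.

End Semantics.

Section AlgorithmDelta.
Variable V : Type.

Fixpoint map_prog (A B : Type) (f : A -> prog V B) (s : seq A) :
    prog V (seq B) :=
  match s with
  | [::] => Step (Ret [::])
  | a :: s' =>
      Step (let! b := f a in let! t := map_prog f s' in Ret (b :: t))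
  end.

Variables (n : nat) (I : instance V n).

(* Insertion sort, stable because j is inserted before the vehicles of larger
   initial index that have the same rate. *)
Fixpoint insert_vehicle (j : 'I_n) (s : seq 'I_n) : prog V (seq 'I_n) :=
  match s with
  | [::] => Step (Ret [:: j])
  | i :: s' =>
      Step (Leq (rate I j) (rate I i) (fun b =>
        if b then Ret [:: j, i & s']
        else let! t := insert_vehicle j s' in Ret (i :: t)))
  end.

Fixpoint sort_vehicles (s : seq 'I_n) : prog V (seq 'I_n) :=
  match s with
  | [::] => Step (Ret [::])
  | j :: s' => Step (let! t := sort_vehicles s' in insert_vehicle j t)
  end.

(* Whether S_j1 - (delta_j / C_j) * D_1 * lambda >= beta_j. *)
Definition eligible (lambda : V) (j : 'I_n) : prog V bool :=
  Arith Div (rate I j) (cap I j) (fun x =>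
  Arith Mul x (len I) (fun y =>
  Arith Mul y lambda (fun z =>
  Arith Sub (soc I j) z (fun t =>
  Leq (minsoc I j) t Ret)))).

(* From here on a set of vehicles is represented by its characteristic
   vector along the list `order' of the vehicles sorted by rate: the index of
   a vehicle after reindexing is its place in that list. *)

Definition eligible_set (order : seq 'I_n) (k : 'I_n) : prog V bitseq :=
  One (fun one => Arith Sub one (red I k) (fun lambda =>
    map_prog (eligible lambda) order)).

Definition empty_set (order : seq 'I_n) : prog V bitseq :=
  map_prog (fun _ => Ret false) order.

Fixpoint first_vehicle (order : seq 'I_n) (E : bitseq) :
    prog V (option 'I_n) :=
  match order, E with
  | j :: order', b :: E' =>
      Step (if b then Ret (Some j) else first_vehicle order' E')
  | _, _ => Step (Ret None)
  end.

Fixpoint add_vehicle (u : 'I_n) (order : seq 'I_n) (W : bitseq) :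
    prog V bitseq :=
  match order, W with
  | j :: order', b :: W' =>
      Step (if j == u then Ret (true :: W')
            else let! t := add_vehicle u order' W' in Ret (b :: t))
  | _, _ => Step (Ret [::])
  end.

Fixpoint set_diff (E W : bitseq) : prog V bitseq :=
  match E, W with
  | e :: E', w :: W' => Step (let! t := set_diff E' W' in Ret (e && ~~ w :: t))
  | _, _ => Step (Ret [::])
  end.

(* Steps 1 and 2, where E is the current E_q (from which the vehicles already
   assigned have been removed), Es lists the initial E_{q+1}, ..., E_n and W is
   the set of the vehicles assigned to positions before q.  The result lists
   the vehicles assigned to positions q, ..., n. *)
Fixpoint assign (order : seq 'I_n) (W E : bitseq) (Es : seq bitseq) :
    prog V (option (seq 'I_n)) :=
  Step (
  let! found := first_vehicle order E in
  match found, Es with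
  | None, _ => Ret None
  | Some u, [::] => Ret (Some [:: u])
  | Some u, E' :: Es' =>
      let! W' := add_vehicle u order W in
      let! E'' := set_diff E' W' in
      let! rest := assign order W' E'' Es' in
      Ret (omap (cons u) rest)
  end).

(* The input also provides the list enum 'I_n of the vehicles in initial order,
   which serves as the list of the positions as well. *)
Definition algorithm_delta : prog V (option (seq 'I_n)) :=
  let! order := sort_vehicles (enum 'I_n) in
  let! Es := map_prog (eligible_set order) (enum 'I_n) in
  let! W := empty_set order in
  match Es with
  | [::] => Ret (Some [::])
  | E :: Es' => assign order W E Es'
  end.

End AlgorithmDelta.

(* Main.v *)
(* The eligible sets are nested: a vehicle that can take a position can also
   take every later one, where less energy is used.  Let W be the set of the
   first k vehicles (counting positions from 0) in the line-up built by the
   algorithm.  A feasible solution has k + 1 vehicles in positions 0, ..., k, so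
   one of them, say v, is outside W, and v is eligible for position k by
   nestedness.  Hence the algorithm does not get stuck, and it chooses for
   position k a vehicle whose rate is at most that of v; as v uses a position
   up to k, it needs at least as much energy in the feasible solution as the
   chosen vehicle in position k. *)

Require Import Defs.

From mathcomp Require Import all_boot all_order all_algebra all_fingroup.
From mathcomp Require Import zify.

Set Implicit Arguments.
Unset Strict Implicit.
Unset Printing Implicit Defensive.

Import Order.TTheory GRing.Theory Num.Theory.
Local Open Scope ring_scope.

(** * Permutations and line-ups *)

(** Pigeonhole: the k + 1 vehicles in positions 0, ..., k are distinct, too many to lie all in
    [W]. *)
Lemma exists_early_notin n (p : {perm 'I_n}) (k : 'I_n) (W : seq 'I_n) :
  (size W <= k)%N -> exists2 j, (p j <= k)%N & j \notin W.
Proof.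
move=> szW; pose f (i : 'I_k.+1) := (p^-1)%g (widen_ord (ltn_ord k) i).
have f_inj : injective f.
  by move=> i j /perm_inj /(congr1 val) /= ij; apply: val_inj.
pose fs := [seq f i | i <- enum 'I_k.+1].
case: (boolP (all (mem W) fs)) => [/allP sub | /allPn].
  have : (size fs <= size W)%N.
    apply: uniq_leq_size sub; rewrite map_inj_uniq //; exact: enum_uniq.
  by rewrite size_map size_enum_ord leqNgt ltnS szW.
case=> _ /mapP[i _ ->] fiW; exists (f i) => //.
by rewrite permKV /= -ltnS.
Qed.

Lemma lineup_of_uniq n (s : seq 'I_n) :
    size s = n -> uniq s ->
  exists2 p, s = lineup p & forall (j0 : 'I_n) k, nth j0 s (p k) = k.
Proof.
move=> szs us; have szs' : size s == n by apply/eqP.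
pose f := tnth (Tuple szs').
have f_inj : injective f by apply/tuple_uniqP.
(* The list maps positions to vehicles, whereas a solution maps vehicles to positions; hence the
   inverse. *)
exists (perm f_inj)^-1%g.
  rewrite /lineup invgK (eq_map (permE f_inj)).
  by rewrite map_tnth_enum.
move=> j0 k.
by rewrite -[RHS](permKV (perm f_inj)) permE /f (tnth_nth j0).
Qed.

(** * Values and costs of programs *)

Section Programs.
Variable R : realFieldType.

Lemma eval_bind (A B : Type) (m : prog R A) (f : A -> prog R B) :
  eval (bind m f) = eval (f (eval m)).
Proof. by elim: m => //= [k IH|o x y k IH|x y k IH]; rewrite IH. Qed.

Lemma cost_bind (A B : Type) (m : prog R A) (f : A -> prog R B) :
  cost (bind m f) = (cost m + cost (f (eval m)))%N.
Proof.
by elim: m => //= [k IH|o x y k IH|x y k IH|m IH]; rewrite IH addSn.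
Qed.

Lemma eval_map_prog (A B : Type) (f : A -> prog R B) s :
  eval (map_prog f s) = [seq eval (f a) | a <- s].
Proof. by elim: s => //= a s IH; rewrite !eval_bind IH. Qed.

Lemma cost_map_prog (A B : Type) (f : A -> prog R B) s c :
  (forall a, cost (f a) <= c)%N -> (cost (map_prog f s) <= size s * c.+1 + 1)%N.
Proof.
move=> fc; elim: s => //= a s IH; rewrite !cost_bind /= addn0 mulSn.
by have := fc a; lia.
Qed.

(** * Sorting the vehicles by rate *)

Variables (n : nat) (I : instance R n).

Local Notation rate_le := (relpre (rate I) <=%O).

Lemma perm_insert_vehicle j s :
  perm_eq (eval (insert_vehicle I j s)) (j :: s).
Proof.
elim: s => //= i s IH; case: (rate I j <= rate I i) => //=.
rewrite eval_bind /=; have : perm_eq (i :: j :: s) [:: j, i & s].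
  by rewrite (perm_catCA [:: i] [:: j] s).
by apply: perm_trans; rewrite perm_cons.
Qed.

Lemma sorted_insert_vehicle j s :
  sorted rate_le s -> sorted rate_le (eval (insert_vehicle I j s)).
Proof.
(* The induction must remember the entry [i] before the current tail, since the inserted vehicle may
   come right after it. *)
have path_insert i t : rate_le i j -> path rate_le i t ->
    path rate_le i (eval (insert_vehicle I j t)).
  elim: t i => [|h t IH] i /= ij; first by rewrite ij.
  case/andP=> ih ht; case: leP => /= [jh|/ltW hj]; first by rewrite ij jh.
  by rewrite eval_bind /= ih IH.
case: s => //= i s si; case: leP => /= [->//|/ltW ij].
by rewrite eval_bind /= path_insert.
Qed.

Lemma perm_sort_vehicles s : perm_eq (eval (sort_vehicles I s)) s.
Proof.
elim: s => //= j s IH; rewrite eval_bind.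
rewrite (perm_trans (perm_insert_vehicle _ _)) //.
by rewrite perm_cons.
Qed.

Lemma sorted_sort_vehicles s : sorted rate_le (eval (sort_vehicles I s)).
Proof. by elim: s => //= j s IH; rewrite eval_bind sorted_insert_vehicle. Qed.

Lemma cost_insert_vehicle j s :
  (cost (insert_vehicle I j s) <= 2 * size s + 1)%N.
Proof.
elim: s => //= i s IH; case: (rate I j <= rate I i) => /=; first by lia.
by rewrite cost_bind /=; lia.
Qed.

Lemma cost_sort_vehicles s :
  (cost (sort_vehicles I s) <= (size s).+1 * (2 * size s + 2))%N.
Proof.
elim: s => //= j s IH; rewrite cost_bind.
have := cost_insert_vehicle j (eval (sort_vehicles I s)).
rewrite (perm_size (perm_sort_vehicles s)); move: IH.
by move: (cost _) (cost _) (size s) => a b c; nia.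
Qed.

(** * Sets of vehicles as bit vectors *)

(** The operations are in the order in which [eligible] performs them, so that evaluating the
    program yields this test by computation. *)
Definition eligibleb (k j : 'I_n) : bool :=
  minsoc I j <= soc I j - rate I j / cap I j * len I * (1 - red I k).

Lemma eval_eligible_set order k :
  eval (eligible_set I order k) = [seq eligibleb k j | j <- order].
Proof. by rewrite /= eval_map_prog. Qed.

(** Each vehicle costs five instructions and one [Step]; the remaining 3 pays for computing 1 -
    eta_k and for the end of the list. *)
Lemma cost_eligible_set order k :
  (cost (eligible_set I order k) <= 6 * size order + 3)%N.
Proof.
have : (cost (map_prog (eligible I (1 - red I k)%R) order)
    <= size order * 6 + 1)%N.
  exact: cost_map_prog.
by rewrite /=; move: (cost _) => c; lia.
Qed.

Lemma eval_first_vehicle order (e : pred 'I_n) :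
  eval (first_vehicle R order [seq e j | j <- order]) = ohead (filter e order).
Proof. by elim: order => //= j s IH; case: (e j). Qed.

Lemma cost_first_vehicle (order : seq 'I_n) E :
  (cost (first_vehicle R order E) <= (size order).+1)%N.
Proof. by elim: order E => [|j s IH] [|[] E] //=; apply: IH. Qed.

(** The program stops at the first occurrence of [u]; without duplicates in [order], the bits after
    it are already right. *)
Lemma eval_add_vehicle u order (W : seq 'I_n) : uniq order ->
  eval (add_vehicle R u order [seq j \in W | j <- order])
    = [seq j \in u :: W | j <- order].
Proof.
elim: order => //= j s IH /andP[js us]; rewrite inE.
case: eqVneq => [ju|_] /=; last by rewrite eval_bind /= IH.
congr cons; apply/eq_in_map => i i_s; rewrite inE -ju.
by case: eqVneq => [ij|//]; rewrite -ij i_s in js.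
Qed.

Lemma size_add_vehicle u (order : seq 'I_n) W :
  (size (eval (add_vehicle R u order W)) <= size W)%N.
Proof.
elim: order W => [|j s IH] [|b W] //=; case: eqP => //= _.
by rewrite eval_bind; apply: IH.
Qed.

Lemma cost_add_vehicle u (order : seq 'I_n) W :
  (cost (add_vehicle R u order W) <= (size order).+1)%N.
Proof.
elim: order W => [|j s IH] [|b W] //=; case: eqP => //= _.
by rewrite cost_bind /= addn0; apply: IH.
Qed.

Lemma eval_set_diff (A : Type) (e w : pred A) s :
  eval (set_diff R [seq e j | j <- s] [seq w j | j <- s])
    = [seq e j && ~~ w j | j <- s].
Proof. by elim: s => //= j s IH; rewrite eval_bind IH. Qed.

Lemma cost_set_diff E W : (cost (set_diff R E W) <= (size W).+1)%N.
Proof.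
elim: E W => [|e E IH] [|w W] //=.
by rewrite cost_bind /= addn0; apply: IH.
Qed.

(** Each position costs at most one [Step] and three list traversals of cost at most N + 1. *)
Lemma cost_assign N (order : seq 'I_n) W E Es :
    (size order <= N)%N -> (size W <= N)%N ->
  (cost (assign R order W E Es) <= (size Es).+1 * (3 * N + 4))%N.
Proof.
move=> so; elim: Es W E => [|E' Es IH] W E sW /=; rewrite cost_bind.
  have := cost_first_vehicle order E.
  by case: (eval (first_vehicle _ _ _)) => [u|] /=; lia.
have := cost_first_vehicle order E.
case: (eval (first_vehicle _ _ _)) => [u|] /=; last by lia.
rewrite !cost_bind.
have := cost_add_vehicle u order W.
have := size_add_vehicle u order W.
set W' := eval (add_vehicle _ _ _ _) => sW'.
have := cost_set_diff E' W'.
have := IH W' (eval (set_diff R E' W')) (leq_trans sW' sW).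
by rewrite [X in (_ <= X)%N -> _]mulSn [X in _ -> (_ <= X)%N]mulSn /=; lia.
Qed.

Lemma cost_algorithm_delta : (0 < n)%N ->
  (cost (algorithm_delta I) <= 40 * n ^ 2)%N.
Proof.
move=> n0; rewrite /algorithm_delta !cost_bind.
set order := eval (sort_vehicles _ _).
have so : size order = n.
  by rewrite (perm_size (perm_sort_vehicles _)) size_enum_ord.
have := cost_sort_vehicles (enum 'I_n); rewrite size_enum_ord.
have := cost_map_prog (enum 'I_n) (cost_eligible_set order).
rewrite size_enum_ord so.
have : (cost (empty_set R order) <= size order * 1 + 1)%N.
  by apply: cost_map_prog.
rewrite !eval_map_prog so.
have := size_map (fun k => eval (eligible_set I order k)) (enum 'I_n).
rewrite size_enum_ord.
case: [seq _ | _ <- _] => [|E Es] /= sz; first by lia.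
have := @cost_assign n order [seq false | _ <- order] E Es.
rewrite size_map so leqnn sz => /(_ isT isT).
(* The bounds for sorting, the eligible sets, the empty set and the assignment add up to 11n^2 + 13n
   + 4, which is at most 28n^2 for n > 0. *)
by nia.
Qed.

(** * The greedy assignment *)

Definition best_choice (k : 'I_n) (W : seq 'I_n) (u : 'I_n) :=
  [/\ eligibleb k u, u \notin W &
      forall j, eligibleb k j -> j \notin W -> rate I u <= rate I j].

(** Loop invariant: [k :: ks] are the positions still to fill and [catrev (take i s) W] holds the
    vehicles placed before the i-th of them, latest first. On failure, [W'] holds the vehicles
    placed so far, among them all those eligible for the position that cannot be filled. *)
Lemma eval_assign order (W : seq 'I_n) k ks :
    uniq order -> sorted rate_le order -> (forall j, j \in order) ->
  match eval (assign R order [seq j \in W | j <- order]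
                [seq eligibleb k j && (j \notin W) | j <- order]
                [seq [seq eligibleb l j | j <- order] | l <- ks]) with
  | Some s => size s = size (k :: ks) /\
      forall i j0, (i < size (k :: ks))%N ->
        best_choice (nth j0 (k :: ks) i) (catrev (take i s) W) (nth j0 s i)
  | None => exists i (W' : seq 'I_n), [/\ (i < size (k :: ks))%N,
      size W' = (size W + i)%N &
      forall j j0, eligibleb (nth j0 (k :: ks) i) j -> j \in W']
  end.
Proof.
move=> uo so oT.
(* Filtering keeps [order] sorted by rate, so the head of the filtered list has the least rate. *)
have best l X :
  if ohead [seq j <- order | eligibleb l j && (j \notin X)] is Some u
  then best_choice l X u else forall j, eligibleb l j -> j \in X.
  set e := fun j => _.
  case Es: (filter e order) => [|u s] /=.
    move=> j lj; apply: contraT => jX.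
    have : j \in filter e order by rewrite mem_filter /e lj jX oT.
    by rewrite Es.
  have : u \in filter e order by rewrite Es mem_head.
  rewrite mem_filter => /andP[/andP[lu uX] _]; split=> // j lj jX.
  have : j \in filter e order by rewrite mem_filter /e lj jX oT.
  have : sorted rate_le (filter e order).
    by apply: sorted_filter so => a b c /=; apply: le_trans.
  rewrite Es /= inE => us /predU1P[->//|js].
  have/allP := order_path_min (fun a b c => @le_trans _ _ _ _ _) us.
  by move/(_ _ js).
elim: ks W k => [|l ks IH] W k /=; rewrite eval_bind eval_first_vehicle;
    have := best k W; case: (ohead _) => [u bu|none] /=.
- by split=> // -[|i].
- by exists 0, W; split=> [||j j0]; rewrite ?addn0 //; apply: none.
- rewrite !eval_bind eval_add_vehicle // eval_set_diff.
  (* [catrev (take i.+1 (u :: s)) W] computes to [catrev (take i s) (u :: W)], so the invariant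
     carries over with the index shifted by one. *)
  have := IH (u :: W) l.
  case: (eval _) => [s [szs bs]|[i [W' [ik sW' W'P]]]] /=.
    by split=> [|[|i] j0 //= ik]; [rewrite szs | apply: bs].
  by exists i.+1, W'; split=> //; rewrite sW' addnS.
- by exists 0, W; split=> [||j j0]; rewrite ?addn0 //; apply: none.
Qed.

Lemma eval_algorithm_delta : (0 < n)%N ->
  match eval (algorithm_delta I) with
  | Some s => size s = n /\
      forall (k : 'I_n) j0, best_choice k (catrev (take k s) [::]) (nth j0 s k)
  | None => exists (k : 'I_n) (W : seq 'I_n), size W = k /\
      forall j, eligibleb k j -> j \in W
  end.
Proof.
move=> n0; rewrite /algorithm_delta !eval_bind.
have po := perm_sort_vehicles (enum 'I_n).
have so := sorted_sort_vehicles (enum 'I_n).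
move: (eval (sort_vehicles _ _)) po so => order po so.
have uo : uniq order by rewrite (perm_uniq po) enum_uniq.
have oT j : j \in order by rewrite (perm_mem po) mem_enum.
rewrite eval_map_prog (eq_map (eval_eligible_set order)) eval_map_prog.
have := size_enum_ord n; have := @nth_ord_enum n.
case: (enum 'I_n) => [_ /= n00|k ks nthE sz]; first by rewrite -n00 in n0.
have := eval_assign [::] k ks uo so oT.
(* Nothing is assigned yet, so removing the assigned vehicles leaves the first eligible set
   unchanged. *)
rewrite [in X in X -> _](eq_map (fun j => andbT (eligibleb k j))) /=.
case: (eval _) => [s [szs bs]|[i [W [ik sW WP]]]].
  split=> [|j j0]; first by rewrite szs.
  by have := bs j j0; rewrite /= -/(size (k :: ks)) sz nthE; apply.
rewrite -/(size (k :: ks)) sz in ik; exists (Ordinal ik), W; split=> // j kj.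
by apply: (WP j k); rewrite (nthE k (Ordinal ik)).
Qed.

(** * Feasibility and optimality *)

Hypothesis I_valid : valid I.

Lemma final_socE p j : (minsoc I j <= final_soc I p j) = eligibleb (p j) j.
Proof.
rewrite /final_soc /energy /eligibleb; congr (_ <= _ - _).
by rewrite (mulrC (len I)) mulrAC; congr (_ * _); rewrite mulrAC.
Qed.

Lemma eligibleb_leq (k l j : 'I_n) :
  (k <= l)%N -> eligibleb k j -> eligibleb l j.
Proof.
case: I_valid => len0 cr0 _ _ [_ redP] kl /le_trans; apply.
have [cap0 rate0] := cr0 j.
have pos : 0 < rate I j / cap I j * len I by rewrite mulr_gt0 ?divr_gt0.
by rewrite lerD2l lerN2 ler_pM2l // lerD2l lerN2 redP.
Qed.

(** Serves twice: to refute feasibility when the algorithm fails, and to find the vehicle whose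
    energy bounds that of a chosen one. *)
Lemma exists_early_eligible p (k : 'I_n) (W : seq 'I_n) :
    feasible I p -> (size W <= k)%N ->
  exists j, [/\ (p j <= k)%N, j \notin W & eligibleb k j].
Proof.
move=> fp /(exists_early_notin p)[j pk jW]; exists j; split=> //.
by apply: eligibleb_leq pk _; rewrite -final_socE.
Qed.

Lemma algorithm_delta_solves : (0 < n)%N ->
  solves I (eval (algorithm_delta I)).
Proof.
move=> n0; have := eval_algorithm_delta n0.
case: (eval _) => [s [sz bs]|[k [W [sW WP]]]] /=; last first.
  move=> p fp; have kW : (size W <= k)%N by rewrite sW.
  by have [j [_ /negP jW /WP]] := exists_early_eligible fp kW.
have us : uniq s.
  (* A vehicle repeated at places i < k would be among those placed before k, which the choice at k
     excludes. *)
  apply: contraT => /(uniqPn (Ordinal n0))[i [k [ik ks nth_ik]]].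
  rewrite sz in ks; have [_ + _] := bs (Ordinal ks) (Ordinal n0).
  rewrite catrevE cats0 mem_rev /= -nth_ik -(nth_take _ ik) mem_nth //.
  by rewrite size_take sz ks.
have [p sE nth_p] := lineup_of_uniq sz us; exists p => //; split=> [j|p' fp'].
  by rewrite final_socE; have [+ _ _] := bs (p j) j; rewrite nth_p.
(* The default 0 is below the other maximum; it remains to bound each energy separately. *)
apply: bigmax_le => [|j _]; first exact: bigmax_ge_id.
have [_ _ min_j] := bs (p j) j; rewrite nth_p in min_j.
have kW : (size (catrev (take (p j) s) [::]) <= p j)%N.
  by rewrite catrevE cats0 size_rev size_take; case: ltnP.
have [v [vk vW ev]] := exists_early_eligible fp' kW.
have {}min_j := min_j v ev vW.
apply: le_trans (le_bigmax _ _ v).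
case: I_valid => len0 cr0 _ _ [red01 redP].
have [_ rv0] := cr0 v; have [_ rj0] := cr0 j; have /andP[_ red1] := red01 (p j).
(* Both factors grow from [j] to [v]: the rate by the greedy choice, and 1 - eta because [p' v] is
   at most [p j]. *)
rewrite /energy; apply: ler_pM.
- by rewrite mulr_ge0 ?(ltW len0) ?(ltW rj0).
- by rewrite subr_ge0 (ltW red1).
- by rewrite ler_pM2l.
- by rewrite lerD2l lerN2 redP.
Qed.

End Programs.

Theorem proposition12 (R : realFieldType) :
  (forall (n : nat) (I : instance R n), (0 < n)%N -> valid I ->
     solves I (eval (algorithm_delta I)))
  /\
  (exists c : nat, forall (n : nat) (I : instance R n), (0 < n)%N -> valid I ->
     (cost (algorithm_delta I) <= c * n ^ 2)%N).
Proof.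
split=> [n I n0 vI|]; first exact: algorithm_delta_solves.
by exists 40 => n I n0 _; apply: cost_algorithm_delta.
Qed.
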